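(* Let $J$ be a finite set with $m:=|J|\ge 2$, let $\Pi=(P_x)_{x\in J}$ be a partition of a finite set $P$ of participants, let $\mathcal{Z}=(J,h,\boldsymbol g)$ be a uniform polymatroid with increment sequence $\boldsymbol g=(g_i)_{0\le i\le m}$ and $0<g_0<|P_x|$ for all $x\in J$, let $\Delta\subseteq\mathcal{P}(J)\setminus\{\emptyset\}$ be a monotone increasing family compatible with $\mathcal{Z}$, and let $\Gamma=\Gamma(\Pi,\mathcal{Z},\Delta)$. If $\Gamma$ is hierarchical, then every chain of blocks in $\Pi$ (with respect to the hierarchical preorder induced by $\Gamma$) contains $1$ or $2$ blocks.
   Context: Polymatroids. For a finite set $J$ let $\mathcal{P}(J)$ be its power set. An (integer) polymatroid is a pair $(J,h)$ with $h:\mathcal{P}(J)\to\mathbb{N}_0$ such that $h(\emptyset)=0$, $h(X)\le h(Y)$ if $X\subseteq Y$, and $h(X\cap Y)+h(X\cup Y)\le h(X)+h(Y)$. It is uniform if $h(X)=h(Y)$ whenever $|X|=|Y|$; write $h_i=h(X)$ for $|X|=i$. With $m=|J|$, its increment sequence is $\boldsymbol g=(g_0,\dots,g_m)$, $g_i=h_{i+1}-h_i$ for $0\le i\le m-1$ and $g_m=0$; it is a nonincreasing sequence of nonnegative integers, and $g_0>0$ is assumed. Such a polymatroid is written $\mathcal{Z}=(J,h,\boldsymbol g)$. Compatibility. A monotone increasing family $\Delta\subseteq\mathcal{P}(J)\setminus\{\emptyset\}$ is a nonempty family of nonempty subsets of $J$ closed under taking supersets in $J$. Fix $x_0\notin J$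 and define $h'$ on $\mathcal{P}(J\cup\{x_0\})$ by $h'(X)=h(X)$ for $X\subseteq J$, $h'(X\cup\{x_0\})=h(X)$ if $X\in\Delta$, and $h'(X\cup\{x_0\})=h(X)+1$ if $X\subseteq J$, $X\notin\Delta$. $\Delta$ is compatible with $\mathcal{Z}$ if $h'$ is monotone increasing and submodular. Access structure. A partition $\Pi=(P_x)_{x\in J}$ of $P$ consists of pairwise disjoint nonempty sets (blocks) with union $P$. For $A\subseteq P$ put $\pi(A)=(|A\cap P_x|)_{x\in J}\in\mathbb{N}_0^J$. For $\bar v\in\mathbb{N}_0^J$ and $Y\subseteq J$ put $\mathrm{supp}(\bar v)=\{x:v_x\ne0\}$, $|\bar v|=\sum_{x\in J}v_x$, $|\bar v_Y|=\sum_{x\in Y}v_x$. For $X\subseteq J$ let $\mathcal{B}(\mathcal{Z},X)=\{\bar v\in\mathbb{N}_0^J:\mathrm{supp}(\bar v)\subseteq X,\ |\bar v|=h(X),\ |\bar v_Y|\le h(Y)\text{ for all }Y\subseteq X\}$. Then $\Gamma(\Pi,\mathcal{Z},\Delta)$ is the family of all $A\subseteq P$ such that $\pi(A)\ge\bar v$ (coordinatewise) for some $\bar v\in\bigcup_{X\in\Delta}\mathcal{B}(\mathcal{Z},X)$. Hierarchy. For participants $p,q\in P$ write $q\preccurlyeq p$ if $A\cup\{p\}\in\Gamma$ for all $A\subseteq P\setminus\{p,q\}$ with $A\cup\{q\}\in\Gamma$. For blocks, $P_y\preccurlyeq P_x$ means $q\preccurlyeq p$ for some (equivalently, all) $q\in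 P_y$, $p\in P_x$; this is a preorder on $\Pi$. Blocks $P_x,P_y$ are comparable if $P_x\preccurlyeq P_y$ or $P_y\preccurlyeq P_x$, and equivalent if both hold. $\Gamma$ is hierarchical if some two different blocks are comparable and no two different blocks are equivalent. A chain is a nonempty set of blocks that are pairwise comparable and such that no two different blocks in it are equivalent. *)

(* Defs.v *)
From mathcomp Require Import all_boot.

Set Implicit Arguments.
Unset Strict Implicit.
Unset Printing Implicit Defensive.

Section Polymatroids.
Variable T : finType.
Implicit Types (f : {set T} -> nat) (X Y : {set T}).

Definition monotone_increasing f : Prop :=
  forall X Y, X \subset Y -> f X <= f Y.

Definition submodular f : Prop :=
  forall X Y, f (X :&: Y) + f (X :|: Y) <= f X + f Y.

Definition polymatroid f : Prop :=
  [/\ f set0 = 0, monotone_increasing f & submodular f].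

Definition uniform f : Prop :=
  forall X Y, #|X| = #|Y| -> f X = f Y.

(* For f uniform and i < #|T|, g i is f_(i+1) - f_i, computed on any sets of
   these sizes; the difference is nonnegative when f is monotone.  The values
   of g beyond #|T| play no role. *)
Definition increment_sequence f (g : nat -> nat) : Prop :=
  (forall X Y, #|Y| = #|X|.+1 -> g #|X| = f Y - f X) /\ g #|T| = 0.

Definition increasing_family (Delta : {set {set T}}) : Prop :=
  [/\ Delta != set0, set0 \notin Delta &
      forall X Y, X \in Delta -> X \subset Y -> Y \in Delta].

(* T with an extra point x0 is option T, where x0 is None. *)
Definition one_point_extension f (Delta : {set {set T}})
    (X : {set option T}) : nat :=
  let X0 := [set x | Some x \in X] in
  if (None \in X) && (X0 \notin Delta) then f X0 + 1 else f X0.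

End Polymatroids.

Definition compatible (J : finType) (h : {set J} -> nat)
    (Delta : {set {set J}}) : Prop :=
  monotone_increasing (one_point_extension h Delta) /\
  submodular (one_point_extension h Delta).

Section AccessStructure.
Variables J P : finType.
Implicit Types (Pi : J -> {set P}) (h : {set J} -> nat) (v : {ffun J -> nat}).

Definition participant_partition Pi : Prop :=
  [/\ forall x, Pi x != set0,
      forall x y, x != y -> [disjoint Pi x & Pi y] &
      \bigcup_x Pi x = [set: P]].

Definition profile Pi (A : {set P}) : {ffun J -> nat} :=
  [ffun x => #|A :&: Pi x|].

Definition vsupp v : {set J} := [set x | v x != 0].

Definition vsum_on v (Y : {set J}) : nat := \sum_(x in Y) v x.

Definition polymatroid_bases h (X : {set J}) v : Prop :=
  [/\ vsupp v \subset X,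
      \sum_x v x = h X &
      forall Y : {set J}, Y \subset X -> vsum_on v Y <= h Y].

Definition access_structure Pi h (Delta : {set {set J}}) (A : {set P}) : Prop :=
  exists v, (exists2 X, X \in Delta & polymatroid_bases h X v) /\
            (forall x, v x <= profile Pi A x).

Definition blocks Pi : {set {set P}} := [set Pi x | x : J].

End AccessStructure.

Section Hierarchy.
Variable P : finType.
Variable Gamma : {set P} -> Prop.
Implicit Types (p q : P) (B C : {set P}).

Definition participant_le q p : Prop :=
  forall A : {set P}, A \subset ~: [set p; q] ->
    Gamma (q |: A) -> Gamma (p |: A).

Definition block_le B C : Prop :=
  exists q p, [/\ q \in B, p \in C & participant_le q p].

Definition block_comparable B C : Prop := block_le B C \/ block_le C B.

Definition block_equivalent B C : Prop := block_le B C /\ block_le C B.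

(* In the next two definitions, Bs is the set of all blocks of a partition. *)
Definition hierarchical (Bs : {set {set P}}) : Prop :=
  (exists B C, [/\ B \in Bs, C \in Bs, B != C & block_comparable B C]) /\
  (forall B C, B \in Bs -> C \in Bs -> B != C -> ~ block_equivalent B C).

Definition chain (Bs K : {set {set P}}) : Prop :=
  [/\ K != set0, K \subset Bs,
      forall B C, B \in K -> C \in K -> block_comparable B C &
      forall B C, B \in K -> C \in K -> B != C -> ~ block_equivalent B C].

End Hierarchy.

(* Main.v *)
(* By compatibility, the support of a basis of a member of Delta is again in
   Delta.  Writing y <= x for P_y being dominated by P_x, move one unit
   from y to x in a basis of a minimal member X of Delta: taking x first in the
   greedy basis shows that x is not in X; taking y last shows that X - y + x is
   in Delta and then, by compatibility, that h (X + x) = h X.  By uniformity h is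
   then constant from size |X| on, so that every set of size |X| contained in
   a member of size |X| + 1 lies in Delta.  Hence if z <= y <= x then Delta is
   invariant under exchanging y and z, which makes y and z equivalent.  Three
   blocks of a chain would always contain such a configuration. *)

Require Import Defs.
From mathcomp Require Import all_boot fingroup perm.

Set Implicit Arguments.
Unset Strict Implicit.
Unset Printing Implicit Defensive.

(** * Greedy bases of a polymatroid *)

Section PolymatroidBases.
Variables (J : finType) (h : {set J} -> nat).
Implicit Types (X Y Z : {set J}) (v w : {ffun J -> nat}).

Lemma vsum_on_vsupp v Y : vsupp v \subset Y -> \sum_x v x = vsum_on v Y.
Proof.
move=> sub; rewrite /vsum_on (bigID (mem Y)) /= [X in _ + X]big1 ?addn0 // => i.
by apply: contraNeq => vi; rewrite (subsetP sub) // inE.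
Qed.

Hypothesis hpoly : polymatroid h.

(** Greedy step: [y] receives its marginal over [X]. For [Y] containing [y], submodularity applied
    to [Y] and [X] bounds this marginal by that of [y] over [Y :\ y]. *)
Lemma basis_add X v y : y \notin X -> polymatroid_bases h X v ->
  polymatroid_bases h (y |: X) [ffun i => if i == y then h (y |: X) - h X else v i].
Proof.
have [_ hmon hsub] := hpoly.
move=> yX [supp tot le]; set w := [ffun i => _].
have wE (Y : {set J}) : y \notin Y -> vsum_on w Y = vsum_on v Y.
  move=> yY; apply: eq_bigr => i iY; rewrite ffunE.
  by case: eqP iY yY => // -> ->.
have suppw : vsupp w \subset y |: X.
  apply/subsetP => i; rewrite !inE ffunE; case: (eqVneq i y) => //= _ vi.
  by apply: (subsetP supp); rewrite inE.
have hX : h X <= h (y |: X) by apply: hmon; apply: subsetUr.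
split=> //.
  rewrite (vsum_on_vsupp suppw) /vsum_on big_setU1 //= ffunE eqxx.
  have := wE X yX; rewrite /vsum_on => ->.
  by rewrite -/(vsum_on v X) -(vsum_on_vsupp supp) tot subnK.
move=> Y sY; have sY' : Y :\ y \subset X by rewrite subDset.
case: (boolP (y \in Y)) => yY; last first.
  rewrite wE //; apply: le; move: sY'; suff -> : Y :\ y = Y by [].
  by apply/setDidPl; rewrite disjoint_sym disjoints1.
rewrite /vsum_on (big_setD1 y) //= ffunE eqxx.
have := wE (Y :\ y); rewrite !inE eqxx /= => /(_ isT); rewrite /vsum_on => ->.
have l1 := le _ sY'; have l2 := hsub Y X.
have e1 : Y :&: X = Y :\ y.
  apply/setP => i; rewrite !inE; case: (eqVneq i y) => [->|iy] /=.
    by rewrite (negPf yX) andbF.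
  case: (boolP (i \in Y)) => //= iY.
  by apply: (subsetP sY'); rewrite !inE iy.
have e2 : Y :|: X = y |: X.
  apply/eqP; rewrite eqEsubset subUset sY subsetUr /=.
  by rewrite setSU // sub1set.
rewrite e1 e2 in l2; rewrite addnBAC // leq_subLR addnC [h X + _]addnC.
by apply: leq_trans l2; rewrite leq_add2r.
Qed.

(** Iterates the greedy step, keeping the old coordinates; the choice of [X] decides which elements
    come first in the greedy order. *)
Lemma basis_extend X Z v : X \subset Z -> polymatroid_bases h X v ->
  exists2 w, polymatroid_bases h Z w & {in X, w =1 v}.
Proof.
move: {2}(#|Z :\: X|) (erefl #|Z :\: X|) => n.
elim: n Z => [|n IH] Z cZ sXZ bv.
  exists v => //; suff -> : Z = X by [].
  apply/eqP; rewrite eqEsubset sXZ andbT -setD_eq0.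
  by rewrite -cards_eq0 cZ.
have [y] : exists y, y \in Z :\: X by apply/card_gt0P; rewrite cZ.
rewrite inE => /andP[yX yZ].
have yD : y \in Z :\: X by rewrite inE yX.
have [||w bw wv] := IH (Z :\ y) _ _ bv.
- move: cZ; rewrite (cardsD1 y) yD add1n => -[<-].
  by apply: eq_card => i; rewrite !inE andbCA.
- apply/subsetP => i iX; rewrite !inE (subsetP sXZ) // andbT.
  by apply: contraNneq yX => <-.
have := @basis_add (Z :\ y) w y; rewrite !inE eqxx /= setD1K // => /(_ isT bw) bw'.
eexists; first exact: bw'.
move=> i iX; rewrite ffunE wv //; case: eqP => // iy.
by rewrite iy (negPf yX) in iX.
Qed.

Lemma basis_set0 : polymatroid_bases h set0 [ffun=> 0].
Proof.
have [h0 _ _] := hpoly.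
split; first by apply/subsetP => i; rewrite !inE ffunE.
  by rewrite h0 big1 // => i _; rewrite ffunE.
by move=> Y _; rewrite /vsum_on big1 // => i _; rewrite ffunE.
Qed.

Lemma basis_set1 x : exists2 v, polymatroid_bases h [set x] v & v x = h [set x].
Proof.
have [h0 _ _] := hpoly.
have := @basis_add set0 _ x; rewrite inE => /(_ _ isT basis_set0) b.
eexists; first by rewrite -[[set x]]setU0; exact: b.
by rewrite ffunE eqxx setU0 h0 subn0.
Qed.

Lemma basis_coord_le X v x : polymatroid_bases h X v -> v x <= h [set x].
Proof.
move=> [supp tot le]; case: (boolP (x \in X)) => xX.
  by have := le [set x]; rewrite sub1set /vsum_on big_set1; apply.
suff -> : v x = 0 by [].
apply/eqP; apply: contraNT xX => vx; apply: (subsetP supp).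
by rewrite inE.
Qed.

(** The coordinates other than [x] sum to at most [h (X :\ x)]. *)
Lemma basis_coord_ge X v x :
  polymatroid_bases h X v -> x \in X -> h X <= v x + h (X :\ x).
Proof.
move=> [supp tot le] xX.
rewrite -tot (vsum_on_vsupp supp) /vsum_on (big_setD1 x) //= leq_add2l.
by apply: le; apply: subD1set.
Qed.

(** Uniformity makes [h] invariant under permutations of [J], so bases are carried to bases. *)
Lemma basis_perm (s : {perm J}) X v : uniform h -> polymatroid_bases h X v ->
  polymatroid_bases h [set x | s x \in X] [ffun x => v (s x)].
Proof.
have hs (Y : {set J}) : #|[set x | s x \in Y]| = #|Y|.
  have -> : [set x | s x \in Y] = s @^-1: Y by apply/setP => x; rewrite !inE.
  exact/card_preimset/perm_inj.
move=> hunif [supp tot le]; split.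
- by apply/subsetP => i; rewrite !inE ffunE => vi; apply: (subsetP supp); rewrite inE.
- rewrite (hunif _ X (hs X)) -tot [RHS](reindex_inj (@perm_inj _ s)).
  by apply: eq_bigr => i _; rewrite ffunE.
move=> Y sY; have E : h (s @: Y) = h Y by apply/hunif/card_imset/perm_inj.
rewrite -E; apply: leq_trans (le (s @: Y) _); last first.
  by apply/subsetP => _ /imsetP[i iY ->]; have := subsetP sY _ iY; rewrite inE.
rewrite /vsum_on big_imset; last by move=> ? ? _ _; apply: perm_inj.
by apply: leq_sum => i _; rewrite ffunE.
Qed.

End PolymatroidBases.

(** * Numerical consequences of compatibility *)

Section Compatibility.
Variables (J : finType) (h : {set J} -> nat) (Delta : {set {set J}}).
Implicit Types (X Y : {set J}).

(** Compatibility is tested below only on sets containing the extra point, where the extension is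
    [h] plus the indicator of lying outside [Delta]. *)
Let cone X : {set option J} := [set o | if o is Some x then x \in X else true].

Let extension_cone X :
  one_point_extension h Delta (cone X) = h X + (X \notin Delta).
Proof.
rewrite /one_point_extension.
have -> : [set x | Some x \in cone X] = X by apply/setP => x; rewrite !inE.
by rewrite inE /=; case: (X \notin Delta); rewrite ?addn0.
Qed.

Hypothesis hcomp : compatible h Delta.

(** Monotonicity of the extension: the extra point adds one at [X] and nothing at [Y]. *)
Lemma compatible_lt X Y :
  X \subset Y -> X \notin Delta -> Y \in Delta -> h X < h Y.
Proof.
move=> sXY XD YD; have [/(_ (cone X) (cone Y)) mon _] := hcomp.
move: mon; rewrite !extension_cone XD YD addn0 addn1; apply.
by apply/subsetP => -[x|]; rewrite !inE //; apply: (subsetP sXY).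
Qed.

(** Submodularity of the extension: of the four sets involved, only the intersection gains one from
    the extra point. *)
Lemma compatible_modular_lt X Y : increasing_family Delta ->
  X \in Delta -> Y \in Delta -> X :&: Y \notin Delta ->
  h (X :&: Y) + h (X :|: Y) < h X + h Y.
Proof.
move=> [_ _ up] XD YD ID; have [_ /(_ (cone X) (cone Y))] := hcomp.
have -> : cone X :&: cone Y = cone (X :&: Y) by apply/setP => -[x|]; rewrite !inE.
have -> : cone X :|: cone Y = cone (X :|: Y) by apply/setP => -[x|]; rewrite !inE.
rewrite !extension_cone XD YD ID (up _ _ XD (subsetUl _ _)) !addn0.
by rewrite addn1 addSn.
Qed.

End Compatibility.

(* The relation P_y <= P_x in terms of profiles: the increments are put on
   opposite sides to avoid truncated subtraction. *)
Definition dominated (J : finType) (h : {set J} -> nat) (Delta : {set {set J}})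
    (y x : J) : Prop :=
  forall X v, X \in Delta -> polymatroid_bases h X v -> 0 < v y ->
  exists v', (exists2 X', X' \in Delta & polymatroid_bases h X' v') /\
             forall i, v' i + (i == y) <= v i + (i == x).

(** * Domination between coordinates and exchange in [Delta] *)

Section Domination.
Variables (J : finType) (h : {set J} -> nat) (Delta : {set {set J}}).
Hypotheses (hpoly : polymatroid h) (hunif : uniform h).
Hypotheses (hDelta : increasing_family Delta) (hcomp : compatible h Delta).
Implicit Types (X Y W : {set J}) (v : {ffun J -> nat}).

(** The total [h X] of [v] is at most [h (vsupp v)], so a support outside [Delta] would contradict
    [compatible_lt]. *)
Lemma basis_vsupp X v : X \in Delta -> polymatroid_bases h X v ->
  vsupp v \in Delta /\ polymatroid_bases h (vsupp v) v.
Proof.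
have [_ hmon _] := hpoly.
move=> XD [supp tot le].
have hS : h X <= h (vsupp v).
  by rewrite -tot (vsum_on_vsupp (subxx _)); apply: le.
split; last split => //.
- apply: contraLR hS => SD; rewrite -ltnNge; exact: (compatible_lt hcomp).
- by apply/eqP; rewrite tot eqn_leq hS hmon.
by move=> Y sY; apply: le; apply: subset_trans supp.
Qed.

Lemma dominated_minimal y x X : dominated h Delta y x -> y != x ->
  minset [pred Y | Y \in Delta] X -> y \in X ->
  [/\ x \notin X, x |: X :\ y \in Delta & h (x |: X) = h X].
Proof.
have [_ hmon hsub] := hpoly; have [_ _ up] := hDelta.
move=> dom nyx /minsetP[/= XD Xmin] yX.
have sW : X :\ y \subset X by apply: subD1set.
have yW : y \notin X :\ y by rewrite !inE eqxx.
have WD : X :\ y \notin Delta.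
  by apply: contra yW => WD; rewrite (Xmin _ WD sW).
have hlt : h (X :\ y) < h X by apply: (compatible_lt hcomp).
(* The [x]-coordinate must really rise: otherwise [v'] lies below [w] with a unit removed at [y],
   its support is all of [X] by minimality, and its total falls short of [h X]. *)
have step w : polymatroid_bases h X w -> 0 < w y -> exists v',
    [/\ vsupp v' \in Delta, polymatroid_bases h (vsupp v') v',
        forall i, v' i + (i == y) <= w i + (i == x) & v' x = (w x).+1].
  move=> bw wy; have [v' [[X' X'D bv'] le']] := dom _ _ XD bw wy.
  have [SD bS] := basis_vsupp X'D bv'.
  exists v'; split=> //; apply/eqP; rewrite eqn_leq.
  have := le' x; rewrite eqxx (eq_sym x y) (negPf nyx) addn0 addn1 => -> /=.
  rewrite ltnNge; apply/negP => vx.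
  have le1 i : v' i + (i == y) <= w i.
    case: (eqVneq i x) => [->|nix]; first by rewrite (eq_sym x y) (negPf nyx) addn0.
    by have := le' i; rewrite (negPf nix) addn0.
  have [suppw totw _] := bw; have [_ totv _] := bS.
  have sSX : vsupp v' \subset X.
    apply: subset_trans suppw; apply/subsetP => i; rewrite !inE -!lt0n => vi.
    by apply: leq_trans vi (leq_trans (leq_addr _ _) (le1 i)).
  have SX := Xmin _ SD sSX.
  have : \sum_i (v' i + (i == y)) <= \sum_i w i by apply: leq_sum.
  rewrite big_split /= totv totw SX (bigD1 y) //= eqxx addnA addn1.
  by rewrite ltnNge leq_addr.
have wy_gt0 w : w y = h X - h (X :\ y) -> 0 < w y by move=> ->; rewrite subn_gt0.
have greedy v : polymatroid_bases h (X :\ y) v ->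
    exists w, [/\ polymatroid_bases h X w, w y = h X - h (X :\ y) &
                  {in X :\ y, w =1 v}].
  move=> bv; have := basis_add hpoly yW bv; rewrite setD1K // => bw.
  eexists; split; first exact: bw; first by rewrite ffunE eqxx.
  by move=> i; rewrite !inE ffunE => /andP[/negPf ->].
(* With [x] first in the greedy order, [w x = h [set x]], and raising it breaks the bound on the
   singleton. *)
have xX : x \notin X.
  apply/negP => xX; have xW : x \in X :\ y by rewrite !inE eq_sym nyx.
  have [u bu ux] := basis_set1 hpoly x.
  have [|v bv vx] := @basis_extend _ _ hpoly _ (X :\ y) _ _ bu.
    by rewrite sub1set.
  have [w [bw wy wv]] := greedy _ bv.
  have [v' [_ bv' _]] := step _ bw (wy_gt0 _ wy).
  rewrite wv // vx ?inE // ux => E.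
  by have := basis_coord_le x bv'; rewrite E ltnn.
(* Any basis of [X :\ y] serves here. As [x] lies outside [X], the exchanged vector has
   [x]-coordinate exactly 1. *)
have [v bv _] := basis_extend hpoly (sub0set (X :\ y)) (basis_set0 hpoly).
have [w [bw wy _]] := greedy _ bv.
have [v' [SD bv' le' v'x]] := step _ bw (wy_gt0 _ wy).
have [suppw totw _] := bw; have [_ totv _] := bv'.
have wx : w x = 0.
  by apply/eqP; apply: contraNT xX => wx; rewrite (subsetP suppw) // inE.
have cardU (T : {set J}) z t : z \notin T -> t \notin T -> h (z |: T) = h (t |: T).
  by move=> zT tT; apply: hunif; rewrite !cardsU1 zT tT.
have xW : x \notin X :\ y by rewrite !inE (negPf xX) andbF.
have hxW : h (x |: X :\ y) = h X by rewrite (cardU _ _ y) // setD1K.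
set S := vsupp v' in SD bv' totv *.
have xS : x \in S by rewrite inE v'x.
have sS : S \subset x |: X.
  apply/subsetP => i; rewrite !inE; case: (eqVneq i x) => //= nix.
  rewrite -lt0n => vi; rewrite (subsetP suppw) // inE -lt0n.
  apply: leq_trans vi (leq_trans (leq_addr (i == y) _) _).
  by have := le' i; rewrite (negPf nix) addn0.
have hSX : h S <= h X.
  rewrite -totv -totw -(leq_add2r 1).
  have : \sum_i (v' i + (i == y)) <= \sum_i (w i + (i == x)) by apply: leq_sum.
  have sum1 z : \sum_(i : J) (i == z) = 1.
    by rewrite (bigD1 z) //= eqxx big1 // => i /negPf ->.
  by rewrite !big_split /= !sum1.
have hSx : h S <= (h (S :\ x)).+1.
  by have := basis_coord_ge bv' xS; rewrite v'x wx add1n.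
have hX : h X <= h (x |: X) by apply: hmon; apply: subsetUr.
(* If the support fills [x |: X], the totals give [h (x |: X) = h X]. By uniformity [x |: X :\ y]
   has this value too, so [compatible_lt] forces it into [Delta]. *)
case: (eqVneq S (x |: X)) => [SE|SE].
  have hE : h (x |: X) = h X by apply/eqP; rewrite eqn_leq hX -SE hSX.
  split=> //; apply/negPn/negP => D.
  have := compatible_lt hcomp _ D SD; rewrite SE setUS // => /(_ isT).
  by rewrite hE hxW ltnn.
have [z zX zS] : exists2 z, z \in X & z \notin S.
  apply/subsetPn; apply: contraNN SE => sXS.
  by rewrite eqEsubset sS subUset sub1set xS sXS.
(* The marginal of x is at most 1 over S - x, hence also over X - z. *)
have hX1 : h X <= (h (X :\ y)).+1.
  have xT : x \notin X :\ z by rewrite !inE (negPf xX) andbF.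
  have eU : S :|: X :\ z = x |: X :\ z.
    apply/setP => i; rewrite !in_setU in_set1; case: (eqVneq i x) => [->|nix].
      by rewrite xS.
    rewrite orFb orb_idl // => iS; rewrite !in_setD1.
    have := subsetP sS _ iS; rewrite in_setU1 (negPf nix) /= => ->.
    by rewrite andbT; apply: contraNneq zS => <-.
  have eI : S :&: (X :\ z) = S :\ x.
    apply/setP => i; rewrite in_setI !in_setD1 andbC.
    case: (boolP (i \in S)) => iS; last by rewrite !andbF.
    have := subsetP sS _ iS; rewrite in_setU1; case: (eqVneq i x) => [->|_ /= ->].
      by rewrite (negPf xX) !andbF.
    by rewrite !andbT; apply: contraNneq zS => <-.
  have zT : z \notin X :\ z by rewrite !inE eqxx.
  have := hsub S (X :\ z); rewrite eU eI (cardU _ _ z) // setD1K //.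
  have -> : h (X :\ z) = h (X :\ y).
    apply: hunif; apply/eqP; rewrite -(eqn_add2l 1).
    by have := cardsD1 y X; have := cardsD1 z X; rewrite yX zX => -> ->.
  move=> sub; rewrite -(leq_add2l (h (S :\ x))) (leq_trans sub) //.
  by rewrite addnS -addSn leq_add2r.
(* By [hX1] the marginal [w y] is at most 1, and the exchange takes that unit away. Hence [S] avoids
   [y] and lies in [x |: X :\ y]. *)
have v'y : v' y = 0.
  have := le' y; rewrite eqxx (negPf nyx) addn0 wy addn1 => lt.
  apply/eqP; rewrite -leqn0 -ltnS; apply: leq_trans lt _.
  by rewrite leq_subLR addn1.
have XxD : x |: X :\ y \in Delta.
  apply: up SD _; apply/subsetP => i iS; have := subsetP sS _ iS.
  rewrite !inE; case: (eqVneq i x) => //= _ ->; rewrite andbT.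
  by move: iS; rewrite inE; apply: contraNneq => ->; rewrite v'y.
split=> //; apply/eqP; rewrite eqn_leq hX andbT.
have eI : X :&: (x |: X :\ y) = X :\ y.
  apply/setP => i; rewrite !inE; case: (eqVneq i x) => [->|_] /=.
    by rewrite (negPf xX) andbF.
  by rewrite andbCA andbb.
have eU : X :|: (x |: X :\ y) = x |: X.
  by rewrite setUCA (setUidPl sW).
(* The unit gained from strictness offsets the unit of slack in [hX1]: [h (X :\ y) + h (x |: X) < h
   X + h X <= (h (X :\ y)).+1 + h X]. *)
have := compatible_modular_lt hcomp hDelta XD XxD; rewrite eI eU => /(_ WD).
rewrite hxW => lt; rewrite -(leq_add2l (h (X :\ y))) -ltnS.
by apply: leq_trans lt _; rewrite -addSn leq_add2r.
Qed.

Lemma minimal_subset X : X \in Delta ->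
  exists2 Y, minset [pred Z | Z \in Delta] Y & Y \subset X.
Proof. by move=> XD; have [Y] := @minset_exists _ [pred Z | Z \in Delta] X XD; exists Y. Qed.

(** Reduces to a minimal member inside [X]; one that avoids [y] survives the removal of [y]. *)
Lemma dominated_exchange y x X : dominated h Delta y x -> y != x ->
  X \in Delta -> y \in X -> x |: X :\ y \in Delta.
Proof.
have [_ _ up] := hDelta.
move=> dom nyx XD yX; have [Y Ymin sYX] := minimal_subset XD.
case: (boolP (y \in Y)) => yY.
  have [_ D _] := dominated_minimal dom nyx Ymin yY.
  by apply: up D _; rewrite setUS // setSD.
have /minsetP[YD _] := Ymin.
apply: up YD _; apply: subset_trans (subsetUr _ _).
by rewrite subsetD1 sYX.
Qed.

(** For a minimal [Y] containing [y], uniformity turns [h (x |: Y) = h Y] into the equality of [h]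
    on [z |: Y] and [z |: Y :\ y]. Since the larger set is in [Delta], [compatible_lt] puts the
    smaller one there. *)
Lemma dominated_between_exchange z y x X :
  dominated h Delta z y -> dominated h Delta y x -> z != y -> y != x ->
  X \in Delta -> y \in X -> z |: X :\ y \in Delta.
Proof.
have [_ _ up] := hDelta.
move=> zy yx nzy nyx XD yX; have [Y Ymin sYX] := minimal_subset XD.
have /minsetP[YD _] := Ymin.
case: (boolP (y \in Y)) => yY; last first.
  by apply: up YD _; apply: subset_trans (subsetUr _ _); rewrite subsetD1 sYX.
have [xY _ hxY] := dominated_minimal yx nyx Ymin yY.
(* If [z] were in [Y], its domination by [y] would expel [y] from [Y]. *)
have zY : z \notin Y.
  apply/negP => zY; have [] := dominated_minimal zy nzy Ymin zY.
  by rewrite yY.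
have hzY : h (z |: Y) = h Y by rewrite -hxY; apply: hunif; rewrite !cardsU1 zY xY.
have hzYy : h (z |: Y :\ y) = h Y.
  by apply: hunif; rewrite cardsU1 (cardsD1 y Y) yY !inE (negPf zY) andbF.
suff D : z |: Y :\ y \in Delta by apply: up D _; rewrite setUS // setSD.
apply/negPn/negP => D; have := compatible_lt hcomp _ D (up _ _ YD (subsetUr [set z] Y)).
by rewrite setUS ?subD1set // hzY hzYy ltnn => /(_ isT).
Qed.

(** Exchange in both directions, one assumed and one from [dominated_exchange], makes [Delta]
    invariant under the transposition of [y] and [z]; transporting [dom] along it reverses the
    roles. *)
Lemma dominated_sym z y : dominated h Delta z y -> z != y ->
  (forall X, X \in Delta -> y \in X -> z |: X :\ y \in Delta) ->
  dominated h Delta y z.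
Proof.
have [_ _ up] := hDelta.
move=> dom nzy exch X v XD bv vy; pose s := tperm y z.
have sD Y : Y \in Delta -> [set i | s i \in Y] \in Delta.
  move=> YD; case: (boolP (y \in Y)) => yY; case: (boolP (z \in Y)) => zY.
  - apply: up YD _; apply/subsetP => i iY; rewrite inE.
    by case: tpermP => // ->.
  - apply: up (exch _ YD yY) _; apply/subsetP => i; rewrite !inE.
    case/orP => [/eqP ->|/andP[niy iY]]; first by rewrite tpermR.
    by rewrite tpermD // 1?eq_sym //; apply: contraNneq zY => <-.
  - apply: up (dominated_exchange dom nzy YD zY) _; apply/subsetP => i; rewrite !inE.
    case/orP => [/eqP ->|/andP[niz iY]]; first by rewrite tpermL.
    by rewrite tpermD // 1?eq_sym //; apply: contraNneq yY => <-.
  - apply: up YD _; apply/subsetP => i iY; rewrite inE.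
    by rewrite tpermD //; apply: contraTneq iY => <-.
have [|v' [[Y YD bv'] le]] := dom _ _ (sD _ XD) (basis_perm s hunif bv).
  by rewrite ffunE tpermR.
exists [ffun i => v' (s i)]; split.
  by exists [set i | s i \in Y]; [apply: sD | apply: basis_perm].
move=> i; have := le (s i); rewrite !ffunE tpermK.
by rewrite -(inj_eq (@perm_inj _ s) i y) -(inj_eq (@perm_inj _ s) i z) tpermL tpermR.
Qed.

End Domination.

(** * From participants and blocks to profiles *)

Section Blocks.
Variables (J P : finType) (Pi : J -> {set P}).
Hypothesis hPi : participant_partition Pi.
Implicit Types (x y i : J) (p q : P) (A : {set P}).

Lemma mem_block x i p : p \in Pi x -> (p \in Pi i) = (i == x).
Proof.
have [_ dis _] := hPi; move=> px; case: eqVneq => [-> //|nix].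
by rewrite (disjointFl (dis _ _ nix)).
Qed.

Lemma block_inj : injective Pi.
Proof.
have [ne _ _] := hPi; move=> x y E; have /set0Pn[p px] := ne x.
by apply/eqP; rewrite -(mem_block x (p := p)) // -E.
Qed.

Lemma profileU1 p x A i : p \in Pi x -> p \notin A ->
  profile Pi (p |: A) i = profile Pi A i + (i == x).
Proof.
move=> px pA; rewrite !ffunE setIUl; case: (eqVneq i x) => [->|nix].
  have /setIidPl -> : [set p] \subset Pi x by rewrite sub1set.
  by rewrite cardsU1 inE (negPf pA) addnC.
have -> : [set p] :&: Pi i = set0.
  by apply/setP => r; rewrite !inE; case: eqP => // ->; rewrite (mem_block i px) (negPf nix).
by rewrite set0U addn0.
Qed.

Lemma profile_exists (n : J -> nat) (B : {set P}) :
  (forall i, n i <= #|Pi i :\: B|) ->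
  exists2 A : {set P}, A \subset ~: B & forall i, profile Pi A i = n i.
Proof.
move=> hn; pose F i := [set p in take (n i) (enum (Pi i :\: B))].
have FP i p : p \in F i -> p \in Pi i :\: B.
  by rewrite inE => /mem_take; rewrite mem_enum.
exists (\bigcup_i F i).
  by apply/bigcupsP => i _; apply/subsetP => p /FP; rewrite !inE => /andP[].
move=> i; rewrite ffunE.
have -> : (\bigcup_j F j) :&: Pi i = F i.
  apply/setP => p; rewrite inE; apply/andP/idP => [[/bigcupP[j _ pj] pi]|pi].
    have := FP _ _ pj; rewrite inE => /andP[_ pj'].
    by move: pi; rewrite (mem_block i pj') => /eqP ->.
  split; first by apply/bigcupP; exists i.
  by have := FP _ _ pi; rewrite inE => /andP[].
rewrite cardsE (card_uniqP _) ?take_uniq ?enum_uniq // size_takel //.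
by rewrite -cardE.
Qed.

Variables (h : {set J} -> nat) (Delta : {set {set J}}).
Hypothesis hP : forall x, h [set x] < #|Pi x|.

Let Gamma := access_structure Pi h Delta.

Lemma participant_le_dominated y x q p : y != x -> q \in Pi y -> p \in Pi x ->
  participant_le Gamma q p <-> dominated h Delta y x.
Proof.
move=> nyx qy px.
have nqp : q != p.
  by apply: contraNneq nyx => qp; rewrite -(mem_block y px) -qp.
split=> [le X v XD bv vy|dom A sA [v [[X XD bv] le]]].
  (* [A] realizes [v] short of one unit at [y], which [q] supplies. The strict inequality in [hP]
     leaves room to avoid [p] in its block. *)
  have [|A sA prA] := @profile_exists (fun i => v i - (i == y)) [set p; q].
    move=> i; have := leq_ltn_trans (basis_coord_le i bv) (hP i).
    have -> : Pi i :\: [set p; q] = Pi i :\ q :\ p.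
      by apply/setP => r; rewrite !inE negb_or andbA.
    rewrite (cardsD1 q) (cardsD1 p (_ :\ _)) !inE (mem_block i qy) (mem_block i px).
    rewrite (eq_sym p q) nqp /=.
    case: (eqVneq i y) => [->|_].
      by rewrite (negPf nyx) add0n add1n ltnS leq_subLR add1n; apply: leqW.
    by rewrite add0n subn0; case: (i == x) => [|/ltnW//]; rewrite add1n ltnS.
  have /andP[pA qA] : (p \notin A) && (q \notin A).
    by rewrite -!in_setC -!sub1set -subUset -setCS setCK.
  have [|v' [Gv' le']] := le _ sA.
    exists v; split; first by exists X.
    by move=> i; rewrite (profileU1 _ qy) // prA addnC -leq_subLR.
  exists v'; split=> // i; have := le' i; rewrite (profileU1 _ px) // prA => l.
  apply: leq_trans (leq_add l (leqnn _)) _; rewrite addnAC leq_add2r subnK //.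
  by case: eqVneq => // ->.
have /andP[pA qA] : (p \notin A) && (q \notin A).
  by rewrite -!in_setC -!sub1set -subUset -setCS setCK.
have le1 i : v i <= profile Pi A i + (i == y) by rewrite -(profileU1 _ qy).
(* If [v y = 0], then [q] contributes nothing and [v] is already below the profile of [A]. *)
case: (posnP (v y)) => vy.
  exists v; split; first by exists X.
  move=> i; rewrite (profileU1 _ px) //; apply: leq_trans (leq_addr _ _).
  by have := le1 i; case: eqVneq => [-> _|_]; rewrite ?vy // addn0.
have [v' [Gv' le']] := dom _ _ XD bv vy.
exists v'; split=> // i; rewrite (profileU1 _ px) // -(leq_add2r (i == y)).
by apply: leq_trans (le' i) _; rewrite addnAC leq_add2r.
Qed.

Lemma block_le_dominated y x : y != x ->
  block_le Gamma (Pi y) (Pi x) <-> dominated h Delta y x.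
Proof.
have [ne _ _] := hPi; move=> nyx; split=> [[q [p [qy px]]]|dom].
  by move/(participant_le_dominated nyx qy px).
have [[q qy] [p px]] := (set0Pn _ (ne y), set0Pn _ (ne x)).
by exists q, p; split=> //; apply/(participant_le_dominated nyx qy px).
Qed.

End Blocks.

(** * Excluding three blocks in a chain *)

Theorem theorem4p12 (J P : finType) (Pi : J -> {set P})
    (h : {set J} -> nat) (g : nat -> nat) (Delta : {set {set J}})
    (hJ : 2 <= #|J|)
    (hPi : participant_partition Pi)
    (hpoly : polymatroid h)
    (hunif : uniform h)
    (hg : increment_sequence h g)
    (hg0 : 0 < g 0)
    (hgP : forall x : J, g 0 < #|Pi x|)
    (hDelta : increasing_family Delta)
    (hcomp : compatible h Delta)
    (hhier : hierarchical (access_structure Pi h Delta) (blocks Pi))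
    (K : {set {set P}})
    (hK : chain (access_structure Pi h Delta) (blocks Pi) K) :
  #|K| = 1 \/ #|K| = 2.
Proof.
have [K0 /subsetP sK cmp neq] := hK.
(* Since [h set0 = 0], [g 0] is the value of [h] on singletons. *)
have hP x : h [set x] < #|Pi x|.
  have [h0 _ _] := hpoly; have := hgP x.
  by rewrite -(cards0 J) (hg.1 set0 [set x]) ?cards1 ?cards0 // h0 subn0.
suff : #|K| <= 2.
  by move: K0; rewrite -card_gt0; case: #|K| => [|[|[|]]] // _ _; [left | right].
rewrite leqNgt; apply/negP => /card_gt2P[A [B [C [[AK BK CK] [nAB nBC nCA]]]]].
(* Two consecutive dominations make the two lower blocks equivalent, which a chain forbids. *)
have path3 (Z Y X : {set P}) : Z \in K -> Y \in K -> X \in K -> Z != Y -> Y != X ->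
    block_le (access_structure Pi h Delta) Z Y ->
    block_le (access_structure Pi h Delta) Y X -> False.
  move=> ZK YK XK nZY nYX leZY leYX; apply: (neq Z Y) => //; split=> //.
  move: (sK _ ZK) (sK _ YK) (sK _ XK) nZY nYX leZY leYX.
  move=> /imsetP[z _ ->] /imsetP[y _ ->] /imsetP[x _ ->].
  rewrite !(inj_eq (block_inj hPi)) => nzy nyx.
  have nyz : y != z by rewrite eq_sym.
  move=> /(block_le_dominated hPi _ hP nzy) zy /(block_le_dominated hPi _ hP nyx) yx.
  apply/(block_le_dominated hPi _ hP nyz); apply: dominated_sym => // X' X'D yX'.
  exact: (dominated_between_exchange hpoly hunif hDelta hcomp zy yx).
have [nBA nCB nAC] : [/\ B != A, C != B & A != C].
  by split; rewrite eq_sym.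
(* Every orientation of a triangle contains a directed path with two edges, to which [path3]
   applies. *)
case: (cmp A B AK BK) (cmp B C BK CK) (cmp C A CK AK) => [ab|ba] [bc|cb] [ca|ac].
all: by eauto.
Qed.
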